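(* Let $\mathcal{E}$ be an idempotent-complete exact category, and let $\mathbf{Ac}(\mathcal{E})$ be the full subcategory of acyclic complexes in the homotopy category $\mathbf{K}(\mathcal{E})$ of cochain complexes in $\mathcal{E}$. Define full subcategories (closed under isomorphism in $\mathbf{Ac}(\mathcal{E})$) by $$\mathbf{Ac}(\mathcal{E})^{\le0}=\{E^*\in\mathbf{Ac}(\mathcal{E})\mid E^i=0\text{ for all }i>0\},$$ $$\mathbf{Ac}(\mathcal{E})^{\ge0}=\{E^*\in\mathbf{Ac}(\mathcal{E})\mid E^i=0\text{ for all }i<-2\}.$$ Then the pair $\big[\mathbf{Ac}(\mathcal{E})^{\le0},\mathbf{Ac}(\mathcal{E})^{\ge0}\big]$ defines a $t$-structure on $\mathbf{Ac}(\mathcal{E})$.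
   Context: $\mathbf{K}(\mathcal{E})$ has as objects the (possibly unbounded) cochain complexes in $\mathcal{E}$ and as morphisms the homotopy classes of cochain maps. A cochain complex $(E^*,\partial^* )$ in $\mathcal{E}$ is acyclic if there are admissible short exact sequences $0\to K^i\xrightarrow{\alpha^i}E^i\xrightarrow{\beta^i}K^{i+1}\to0$ with $\partial^i=\alpha^{i+1}\circ\beta^i$ for all $i$. Since $\mathcal{E}$ is idempotent-complete, $\mathbf{Ac}(\mathcal{E})$ is a thick triangulated subcategory of $\mathbf{K}(\mathcal{E})$. *)

(* Defs.v *)
From HB Require Import structures.
From mathcomp Require Import all_boot all_order all_algebra.
From mathcomp Require Import generic_quotient ring_quotient.
From mathcomp Require Import boolp.
Set Implicit Arguments.
Unset Strict Implicit.
Unset Printing Implicit Defensive.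
Import GRing.Theory.
Local Open Scope ring_scope.
Local Open Scope quotient_scope.

Declare Scope cat_scope.
Delimit Scope cat_scope with cat.
Local Open Scope cat_scope.

Record preadditive := Preadditive {
  obj :> Type;
  hom : obj -> obj -> zmodType;
  idm : forall X, hom X X;
  comp : forall X Y Z, hom Y Z -> hom X Y -> hom X Z;
  compmA : forall W X Y Z (h : hom Y Z) (g : hom X Y) (f : hom W X),
    comp h (comp g f) = comp (comp h g) f;
  comp1m : forall X Y (f : hom X Y), comp (idm Y) f = f;
  compm1 : forall X Y (f : hom X Y), comp f (idm X) = f;
  compmDl : forall X Y Z (g1 g2 : hom Y Z) (f : hom X Y),
    comp (g1 + g2) f = comp g1 f + comp g2 f;
  compmDr : forall X Y Z (g : hom Y Z) (f1 f2 : hom X Y),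
    comp g (f1 + f2) = comp g f1 + comp g f2 }.

Arguments hom {p} X Y.
Arguments idm {p} X.
Arguments comp {p X Y Z} g f.
Notation "g ∘ f" := (comp g f) (at level 40, left associativity) : cat_scope.

Section PreadditiveTheory.
Variable C : preadditive.
Implicit Types X Y Z : C.

Lemma comp0m X Y Z (f : hom X Y) : (0 : hom Y Z) ∘ f = 0.
Proof. by apply: (addIr (0 ∘ f)); rewrite -compmDl !add0r. Qed.

Lemma compm0 X Y Z (g : hom Y Z) : g ∘ (0 : hom X Y) = 0.
Proof. by apply: (addIr (g ∘ 0)); rewrite -compmDr !add0r. Qed.

Lemma compNm X Y Z (g : hom Y Z) (f : hom X Y) : (- g) ∘ f = - (g ∘ f).
Proof. by apply: (addIr (g ∘ f)); rewrite -compmDl !addNr comp0m. Qed.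

Lemma compmN X Y Z (g : hom Y Z) (f : hom X Y) : g ∘ (- f) = - (g ∘ f).
Proof. by apply: (addIr (g ∘ f)); rewrite -compmDr !addNr compm0. Qed.

Definition is_iso X Y (f : hom X Y) : Prop :=
  exists g : hom Y X, g ∘ f = idm X /\ f ∘ g = idm Y.

Definition isomorphic X Y : Prop := exists f : hom X Y, is_iso f.

Definition is_zero X : Prop := idm X = 0.

Record biproduct X Y := Biproduct {
  bobj :> C;
  binl : hom X bobj;
  binr : hom Y bobj;
  bprl : hom bobj X;
  bprr : hom bobj Y;
  bprl_inl : bprl ∘ binl = idm X;
  bprr_inr : bprr ∘ binr = idm Y;
  bprl_inr : bprl ∘ binr = 0;
  bprr_inl : bprr ∘ binl = 0;
  binpr : binl ∘ bprl + binr ∘ bprr = idm bobj }.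

Lemma biproduct_ext T X Y (B : biproduct X Y) (f g : hom T B) :
  bprl B ∘ f = bprl B ∘ g -> bprr B ∘ f = bprr B ∘ g -> f = g.
Proof.
move=> fgl fgr; rewrite -[f]comp1m -[g]comp1m -(binpr B) !compmDl.
by rewrite -!compmA fgl fgr.
Qed.

Definition is_kernel X Y Z (i : hom X Y) (p : hom Y Z) : Prop :=
  p ∘ i = 0 /\
  forall (T : C) (f : hom T Y), p ∘ f = 0 -> exists! g : hom T X, i ∘ g = f.

Definition is_cokernel X Y Z (i : hom X Y) (p : hom Y Z) : Prop :=
  p ∘ i = 0 /\
  forall (T : C) (f : hom Y T), f ∘ i = 0 -> exists! g : hom Z T, g ∘ p = f.

Definition is_pushout W X Y Z (f : hom W X) (g : hom W Y)
    (f' : hom X Z) (g' : hom Y Z) : Prop :=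
  f' ∘ f = g' ∘ g /\
  forall (T : C) (s : hom X T) (t : hom Y T), s ∘ f = t ∘ g ->
    exists! u : hom Z T, u ∘ f' = s /\ u ∘ g' = t.

Definition is_pullback W X Y Z (f : hom X W) (g : hom Y W)
    (f' : hom Z X) (g' : hom Z Y) : Prop :=
  f ∘ f' = g ∘ g' /\
  forall (T : C) (s : hom T X) (t : hom T Y), f ∘ s = g ∘ t ->
    exists! u : hom T Z, f' ∘ u = s /\ g' ∘ u = t.

End PreadditiveTheory.

(* The zero object and the binary direct sums are chosen. *)
Record additive := Additive {
  add_cat :> preadditive;
  zero_obj : add_cat;
  zero_objP : is_zero zero_obj;
  dsum : forall X Y : add_cat, biproduct X Y }.

(* [confl i p] says that [0 -> A -i-> B -p-> C -> 0] is an admissible short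
   exact sequence. *)
Section AdmissibleMorphisms.
Variables (C : preadditive)
  (confl : forall X Y Z : C, hom X Y -> hom Y Z -> Prop).

Definition adm_mono X Y (i : hom X Y) : Prop :=
  exists (Z : C) (p : hom Y Z), confl i p.

Definition adm_epi Y Z (p : hom Y Z) : Prop :=
  exists (X : C) (i : hom X Y), confl i p.
End AdmissibleMorphisms.

Record exact_category := ExactCategory {
  exact_add :> additive;
  confl : forall X Y Z : exact_add, hom X Y -> hom Y Z -> Prop;
  confl_ker : forall X Y Z (i : hom X Y) (p : hom Y Z),
    confl i p -> is_kernel i p;
  confl_coker : forall X Y Z (i : hom X Y) (p : hom Y Z),
    confl i p -> is_cokernel i p;
  confl_iso : forall X Y Z X' Y' Z' (i : hom X Y) (p : hom Y Z)
      (i' : hom X' Y') (p' : hom Y' Z')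
      (a : hom X X') (b : hom Y Y') (c : hom Z Z'),
    is_iso a -> is_iso b -> is_iso c ->
    b ∘ i = i' ∘ a -> c ∘ p = p' ∘ b -> confl i p -> confl i' p';
  adm_mono_id : forall X : exact_add, adm_mono confl (idm X);
  adm_epi_id : forall X : exact_add, adm_epi confl (idm X);
  adm_mono_comp : forall X Y Z (i : hom X Y) (j : hom Y Z),
    adm_mono confl i -> adm_mono confl j -> adm_mono confl (j ∘ i);
  adm_epi_comp : forall X Y Z (p : hom X Y) (q : hom Y Z),
    adm_epi confl p -> adm_epi confl q -> adm_epi confl (q ∘ p);
  adm_mono_pushout : forall X Y X' (i : hom X Y) (f : hom X X'),
    adm_mono confl i ->
    exists (Y' : exact_add) (f' : hom Y Y') (i' : hom X' Y'),
      is_pushout i f f' i' /\ adm_mono confl i';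
  adm_epi_pullback : forall Y Z Z' (p : hom Y Z) (f : hom Z' Z),
    adm_epi confl p ->
    exists (Y' : exact_add) (f' : hom Y' Y) (p' : hom Y' Z'),
      is_pullback p f f' p' /\ adm_epi confl p' }.

Definition idempotent_complete (C : preadditive) : Prop :=
  forall (X : C) (e : hom X X), e ∘ e = e ->
    exists (Y : C) (r : hom X Y) (s : hom Y X), r ∘ s = idm Y /\ s ∘ r = e.

Record complex (C : preadditive) := Complex {
  cob :> int -> C;
  diff : forall n, hom (cob n) (cob (n + 1));
  diff2 : forall n, diff (n + 1) ∘ diff n = 0 }.

Arguments diff {C} c n.

Record cmap (C : preadditive) (X Y : complex C) := CMap {
  cm :> forall n, hom (X n) (Y n);
  cmP : forall n, cm (n + 1) ∘ diff X n = diff Y n ∘ cm n }.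

Section ChainMaps.
Variable C : preadditive.
Implicit Types W X Y Z : complex C.

Lemma cmap_eq X Y (f g : cmap X Y) : (forall n, f n = g n) -> f = g.
Proof.
case: f g => [f fP] [g gP] /= fg.
have e : f = g by apply: functional_extensionality_dep.
by rewrite {}e in fP *; congr CMap; apply: Prop_irrelevance.
Qed.

Definition cmap_id X : cmap X X.
Proof. by exists (fun n => idm (X n)) => n; rewrite comp1m compm1. Defined.

Definition cmap_comp X Y Z (g : cmap Y Z) (f : cmap X Y) : cmap X Z.
Proof.
by exists (fun n => g n ∘ f n) => n; rewrite -compmA cmP !compmA cmP.
Defined.

Definition cmap0 X Y : cmap X Y.
Proof. by exists (fun n => 0) => n; rewrite comp0m compm0. Defined.

Definition cmapD X Y (f g : cmap X Y) : cmap X Y.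
Proof.
by exists (fun n => f n + g n) => n; rewrite compmDl compmDr !cmP.
Defined.

Definition cmapN X Y (f : cmap X Y) : cmap X Y.
Proof. by exists (fun n => - f n) => n; rewrite compNm compmN cmP. Defined.

Section Zmod.
Variables X Y : complex C.

HB.instance Definition _ := gen_eqMixin (cmap X Y).
HB.instance Definition _ := gen_choiceMixin (cmap X Y).

Fact cmapDA : associative (@cmapD X Y).
Proof. by move=> f g h; apply: cmap_eq => n; exact: addrA. Qed.
Fact cmapDC : commutative (@cmapD X Y).
Proof. by move=> f g; apply: cmap_eq => n; exact: addrC. Qed.
Fact cmap0D : left_id (cmap0 X Y) (@cmapD X Y).
Proof. by move=> f; apply: cmap_eq => n; exact: add0r. Qed.
Fact cmapND : left_inverse (cmap0 X Y) (@cmapN X Y) (@cmapD X Y).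
Proof. by move=> f; apply: cmap_eq => n; exact: addNr. Qed.

HB.instance Definition _ :=
  GRing.isZmodule.Build (cmap X Y) cmapDA cmapDC cmap0D cmapND.
End Zmod.

(* The usual condition [f^m = h^(m+1) d^m + d^(m-1) h^m], with [m = n + 1] and
   with [h n] standing for the component [X^(n+1) -> Y^n] of the homotopy. *)
Definition nullhomotopic X Y (f : cmap X Y) : Prop :=
  exists h : forall n, hom (X (n + 1)) (Y n),
    forall n, f (n + 1) = h (n + 1) ∘ diff X (n + 1) + diff Y n ∘ h n.

Definition null_pred X Y : {pred cmap X Y} := fun f => `[< nullhomotopic f >].
Arguments null_pred X Y : clear implicits.

Lemma null_predP X Y (f : cmap X Y) :
  reflect (nullhomotopic f) (f \in null_pred X Y).
Proof. exact: asboolP. Qed.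

Fact null_zmod X Y : zmod_closed (null_pred X Y).
Proof.
split=> [|f g /null_predP[h hP] /null_predP[k kP]]; apply/null_predP.
  by exists (fun n => 0) => n; rewrite comp0m compm0 addr0.
exists (fun n => h n - k n) => n; rewrite [LHS]/= hP kP.
by rewrite compmDl compmDr compNm compmN opprD addrACA.
Qed.

HB.instance Definition _ X Y :=
  GRing.isZmodClosed.Build (cmap X Y) (null_pred X Y) (@null_zmod X Y).

Lemma null_compl X Y Z (g : cmap Y Z) (f : cmap X Y) :
  nullhomotopic f -> nullhomotopic (cmap_comp g f).
Proof.
case=> h hP; exists (fun n => g n ∘ h n) => n /=.
by rewrite hP compmDr !compmA cmP.
Qed.

Lemma null_compr X Y Z (g : cmap Y Z) (f : cmap X Y) :
  nullhomotopic g -> nullhomotopic (cmap_comp g f).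
Proof.
case=> h hP; exists (fun n => h n ∘ f (n + 1)) => n /=.
by rewrite hP compmDl -!compmA cmP.
Qed.

Definition shift X : complex C.
Proof.
exists (fun n => X (n + 1)) (fun n => - diff X (n + 1)) => n.
by rewrite compNm compmN opprK diff2.
Defined.

Definition cmap_shift X Y (f : cmap X Y) : cmap (shift X) (shift Y).
Proof.
by exists (fun n => f (n + 1)) => n; rewrite /= compmN compNm cmP.
Defined.

Lemma null_shift X Y (f : cmap X Y) :
  nullhomotopic f -> nullhomotopic (cmap_shift f).
Proof.
case=> h hP; exists (fun n => - h (n + 1)) => n /=.
by rewrite hP !compNm !compmN !opprK.
Qed.

Definition khom X Y : zmodType := {ideal_quot (null_pred X Y)}.

Definition kpi X Y (f : cmap X Y) : khom X Y := \pi f.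

Lemma kpi_repr X Y (f : khom X Y) : kpi (repr f) = f.
Proof. exact: reprK. Qed.

Lemma kpiP X Y (f g : cmap X Y) : kpi f = kpi g <-> nullhomotopic (f - g).
Proof.
split=> [/eqmodP|fg]; first by move/null_predP.
by apply/eqmodP/null_predP.
Qed.

Lemma kpiD X Y (f g : cmap X Y) : kpi (f + g) = kpi f + kpi g.
Proof. exact: Quotient.pi_add. Qed.

Lemma kpi_eq0 X Y (f : cmap X Y) : kpi f = 0 <-> nullhomotopic f.
Proof.
have -> : (0 : khom X Y) = kpi 0.
  by apply: (addIr (kpi 0)); rewrite -kpiD !add0r.
by rewrite kpiP subr0.
Qed.

Definition kid X : khom X X := kpi (cmap_id X).

Definition kcomp X Y Z (g : khom Y Z) (f : khom X Y) : khom X Z :=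
  kpi (cmap_comp (repr g) (repr f)).

Definition kshift X Y (f : khom X Y) : khom (shift X) (shift Y) :=
  kpi (cmap_shift (repr f)).

Lemma kcomp_pi X Y Z (g : cmap Y Z) (f : cmap X Y) :
  kcomp (kpi g) (kpi f) = kpi (cmap_comp g f).
Proof.
apply/kpiP; set g' := repr _; set f' := repr _.
have /kpiP ng : kpi g' = kpi g by rewrite kpi_repr.
have /kpiP nf : kpi f' = kpi f by rewrite kpi_repr.
have -> : cmap_comp g' f' - cmap_comp g f
        = cmap_comp (g' - g) f' + cmap_comp g (f' - f).
  apply: cmap_eq => n.
  change (g' n ∘ f' n - g n ∘ f n
    = (g' n - g n) ∘ f' n + g n ∘ (f' n - f n)).
  by rewrite compmDl compmDr compNm compmN addrA addrNK.
by apply/null_predP/rpredD; apply/null_predP;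
  [exact: null_compr | exact: null_compl].
Qed.

Lemma kshift_pi X Y (f : cmap X Y) : kshift (kpi f) = kpi (cmap_shift f).
Proof.
apply/kpiP; set f' := repr _.
have /kpiP/null_shift : kpi f' = kpi f by rewrite kpi_repr.
by congr nullhomotopic; apply: cmap_eq.
Qed.

Fact kcompA W X Y Z (h : khom Y Z) (g : khom X Y) (f : khom W X) :
  kcomp h (kcomp g f) = kcomp (kcomp h g) f.
Proof.
rewrite -[h]kpi_repr -[g]kpi_repr -[f]kpi_repr !kcomp_pi.
by congr kpi; apply: cmap_eq => n; exact: compmA.
Qed.

Fact kcomp1m X Y (f : khom X Y) : kcomp (kid Y) f = f.
Proof.
rewrite -[f]kpi_repr kcomp_pi; congr kpi.
by apply: cmap_eq => n; exact: comp1m.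
Qed.

Fact kcompm1 X Y (f : khom X Y) : kcomp f (kid X) = f.
Proof.
rewrite -[f]kpi_repr kcomp_pi; congr kpi.
by apply: cmap_eq => n; exact: compm1.
Qed.

Fact kcompDl X Y Z (g1 g2 : khom Y Z) (f : khom X Y) :
  kcomp (g1 + g2) f = kcomp g1 f + kcomp g2 f.
Proof.
rewrite -[g1]kpi_repr -[g2]kpi_repr -[f]kpi_repr -kpiD !kcomp_pi -kpiD.
by congr kpi; apply: cmap_eq => n; exact: compmDl.
Qed.

Fact kcompDr X Y Z (g : khom Y Z) (f1 f2 : khom X Y) :
  kcomp g (f1 + f2) = kcomp g f1 + kcomp g f2.
Proof.
rewrite -[g]kpi_repr -[f1]kpi_repr -[f2]kpi_repr -kpiD !kcomp_pi -kpiD.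
by congr kpi; apply: cmap_eq => n; exact: compmDr.
Qed.

Definition Kcat : preadditive :=
  Preadditive kcompA kcomp1m kcompm1 kcompDl kcompDr.

Fact kshift1 X : kshift (kid X) = kid (shift X).
Proof. by rewrite kshift_pi; congr kpi; apply: cmap_eq. Qed.

Fact kshiftM X Y Z (g : khom Y Z) (f : khom X Y) :
  kshift (kcomp g f) = kcomp (kshift g) (kshift f).
Proof.
rewrite -[g]kpi_repr -[f]kpi_repr kcomp_pi !kshift_pi kcomp_pi.
by congr kpi; apply: cmap_eq.
Qed.

Fact kshiftD X Y (f g : khom X Y) : kshift (f + g) = kshift f + kshift g.
Proof.
rewrite -[f]kpi_repr -[g]kpi_repr -kpiD !kshift_pi -kpiD.
by congr kpi; apply: cmap_eq.
Qed.

End ChainMaps.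

Arguments kpi {C X Y} f.

Section Cone.
Variables (C : additive) (X Y : complex C) (f : cmap X Y).

Let S (n : int) := dsum (X (n + 1)) (Y n).

Definition cone_diff n : hom (S n) (S (n + 1)) :=
  binl (S (n + 1)) ∘ (- diff X (n + 1)) ∘ bprl (S n)
  + binr (S (n + 1)) ∘ (f (n + 1) ∘ bprl (S n) + diff Y n ∘ bprr (S n)).

Fact bprl_cone_diff n :
  bprl (S (n + 1)) ∘ cone_diff n = - diff X (n + 1) ∘ bprl (S n).
Proof.
by rewrite compmDr !compmA bprl_inl bprl_inr comp1m comp0m addr0.
Qed.

Fact bprr_cone_diff n :
  bprr (S (n + 1)) ∘ cone_diff n
  = f (n + 1) ∘ bprl (S n) + diff Y n ∘ bprr (S n).
Proof.
by rewrite compmDr !compmA bprr_inl bprr_inr comp1m !comp0m add0r.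
Qed.

Fact cone_diff2 n : cone_diff (n + 1) ∘ cone_diff n = 0.
Proof.
apply: biproduct_ext; rewrite compm0 compmA.
  rewrite bprl_cone_diff -compmA bprl_cone_diff compmA.
  by rewrite compNm compmN opprK diff2 comp0m.
rewrite bprr_cone_diff compmDl -!compmA bprl_cone_diff bprr_cone_diff.
rewrite compmDr !compmA diff2 comp0m addr0 -compmDl.
by rewrite compmN cmP addNr comp0m.
Qed.

Definition cone : complex C := Complex cone_diff2.

Definition cone_in : cmap Y cone.
Proof.
exists (fun n => binr (S n)) => n; apply: biproduct_ext.
  rewrite /= compmA bprl_inr comp0m [RHS]compmA bprl_cone_diff.
  by rewrite -compmA bprl_inr compm0.
rewrite /= compmA bprr_inr comp1m [RHS]compmA bprr_cone_diff compmDl.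
by rewrite -!compmA bprl_inr bprr_inr compm1 compm0 add0r.
Defined.

Definition cone_out : cmap cone (shift X).
Proof. by exists (fun n => bprl (S n)) => n; exact: bprl_cone_diff. Defined.

End Cone.

(* The data, without the axioms, of a triangulated category: the notion of
   t-structure refers to nothing else. [tr X] is [X[1]], and [distinguished]
   bears on triangles [X -> Y -> Z -> X[1]]. *)
Record triangle_category := TriangleCategory {
  tri_cat :> preadditive;
  tr : tri_cat -> tri_cat;
  trm : forall X Y, hom X Y -> hom (tr X) (tr Y);
  trm1 : forall X, trm (idm X) = idm (tr X);
  trmM : forall X Y Z (g : hom Y Z) (f : hom X Y),
    trm (g ∘ f) = trm g ∘ trm f;
  trmD : forall X Y (f g : hom X Y), trm (f + g) = trm f + trm g;
  distinguished : forall X Y Z,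
    hom X Y -> hom Y Z -> hom Z (tr X) -> Prop }.

Arguments tr {t} X.
Arguments distinguished {t X Y Z} u v w.

Definition full_triangle_subcategory (T : triangle_category) (P : T -> Prop)
  (P_tr : forall X, P X -> P (tr X)) : triangle_category.
Proof.
pose O := {X : T | P X}.
pose C := @Preadditive O (fun X Y => hom (sval X) (sval Y))
  (fun X => idm (sval X)) (fun X Y Z g f => g ∘ f)
  (fun _ _ _ _ => @compmA T _ _ _ _) (fun _ _ => @comp1m T _ _)
  (fun _ _ => @compm1 T _ _) (fun _ _ _ => @compmDl T _ _ _)
  (fun _ _ _ => @compmDr T _ _ _).
exact: (@TriangleCategory C (fun X : O => exist P _ (P_tr _ (svalP X)))
  (fun X Y f => @trm T (sval X) (sval Y) f) (fun X => @trm1 T (sval X))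
  (fun _ _ _ => @trmM T _ _ _) (fun _ _ => @trmD T _ _)
  (fun X Y Z u v w => @distinguished T (sval X) (sval Y) (sval Z) u v w)).
Defined.

(* [tle0] and [tge0] are the classes [D^{<=0}] and [D^{>=0}]. The translation
   of a triangulated category being an automorphism, [X] lies in
   [D^{<=1} = D^{<=0}[-1]] iff [X[1]] lies in [D^{<=0}], and in
   [D^{>=1} = D^{>=0}[-1]] iff [X[1]] lies in [D^{>=0}]. *)
Section TStructure.
Variables (T : triangle_category) (tle0 tge0 : T -> Prop).

Definition tle1 (X : T) : Prop := tle0 (tr X).
Definition tge1 (X : T) : Prop := tge0 (tr X).

Record t_structure : Prop := TStructure {
  tle0_iso : forall X Y : T, isomorphic X Y -> tle0 X -> tle0 Y;
  tge0_iso : forall X Y : T, isomorphic X Y -> tge0 X -> tge0 Y;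
  tle0_tle1 : forall X : T, tle0 X -> tle1 X;
  tge1_tge0 : forall X : T, tge1 X -> tge0 X;
  t_hom0 : forall (X Y : T) (f : hom X Y), tle0 X -> tge1 Y -> f = 0;
  t_truncation : forall X : T,
    exists (A B : T) (u : hom A X) (v : hom X B) (w : hom B (tr A)),
      [/\ tle0 A, tge1 B & distinguished u v w] }.

End TStructure.

Definition K_distinguished (C : additive) (X Y Z : Kcat C)
    (u : hom X Y) (v : hom Y Z) (w : hom Z (shift X : Kcat C)) : Prop :=
  exists (A B : complex C) (f : cmap A B) (a : @hom (Kcat C) X A)
    (b : @hom (Kcat C) Y B) (c : @hom (Kcat C) Z (cone f)),
    [/\ is_iso a, is_iso b & is_iso c] /\
    [/\ kcomp b u = kcomp (kpi f) a,
        kcomp c v = kcomp (kpi (cone_in f)) b &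
        kcomp (kshift a) w = kcomp (kpi (cone_out f)) c].

Definition K (C : additive) : triangle_category :=
  @TriangleCategory (Kcat C) (@shift C) (@kshift C) (@kshift1 C) (@kshiftM C)
    (@kshiftD C) (@K_distinguished C).

Definition acyclic (E : exact_category) (X : complex E) : Prop :=
  exists (Z : int -> E) (alpha : forall i, hom (Z i) (X i))
    (beta : forall i, hom (X i) (Z (i + 1))),
    (forall i, confl (alpha i) (beta i)) /\
    (forall i, diff X i = alpha (i + 1) ∘ beta i).

Lemma acyclic_shift (E : exact_category) (X : complex E) :
  acyclic X -> acyclic (shift X).
Proof.
case=> Z [al [be [ex dE]]].
exists (fun i => Z (i + 1)), (fun i => al (i + 1)), (fun i => - be (i + 1)).
split=> i; last by rewrite /= dE compmN.
apply: (confl_iso (a := idm _) (b := idm _) (c := - idm _)) (ex _).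
- by exists (idm _); rewrite comp1m.
- by exists (idm _); rewrite comp1m.
- by exists (- idm _); rewrite compNm compmN opprK comp1m.
- by rewrite comp1m compm1.
- by rewrite compNm comp1m compm1.
Qed.

Definition Ac (E : exact_category) : triangle_category :=
  @full_triangle_subcategory (K E) (@acyclic E) (@acyclic_shift E).

Definition Ac_complex (E : exact_category) (X : Ac E) : complex E := sval X.

(* The vanishing condition is not invariant under isomorphism in Ac(E), whence
   the closure. *)
Definition Ac_le0 (E : exact_category) (X : Ac E) : Prop :=
  exists Y : Ac E, isomorphic X Y /\
    forall i : int, 0 < i -> is_zero (Ac_complex Y i).

Definition Ac_ge0 (E : exact_category) (X : Ac E) : Prop :=
  exists Y : Ac E, isomorphic X Y /\
    forall i : int, i < - 2 -> is_zero (Ac_complex Y i).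

(* Main.v *)
(* Let X be acyclic, spliced from conflations Z^n -> X^n -> Z^(n+1). Its
   truncations are the acyclic complexes
     A = (... -> X^-2 -> X^-1 -> Z^0 -> 0 -> ...),
     B = (... -> 0 -> Z^0 -> X^0 -> X^1 -> ...)
   with Z^0 in degree 0 of A and in degree -1 of B; an explicit homotopy
   equivalence of B with the cone of A -> X gives the truncation triangle.
   A chain map f : X -> Y with X^n = 0 for n > 0 and Y^n = 0 for n < -1 has
   only the components f^-1 and f^0; X^-1 -> X^0 is a cokernel of
   X^-2 -> X^-1, so f^-1 factors through a map X^0 -> Y^-1, which is a
   homotopy from f to 0. *)

From mathcomp Require Import all_boot order ssralg ssrnum ssrint boolp zify.
Set Implicit Arguments.
Unset Strict Implicit.
Unset Printing Implicit Defensive.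
Import Order.TTheory GRing.Theory Num.Theory.
Require Import Defs.
Local Open Scope ring_scope.
Local Open Scope cat_scope.

(** * Zero objects, isomorphisms and cancellation *)

Section ZeroObjects.
Variable C : preadditive.
Implicit Types X Y Z : C.

Lemma is_zero_from X Y (f : hom X Y) : is_zero X -> f = 0.
Proof. by move=> X0; rewrite -[f]compm1 X0 compm0. Qed.

Lemma is_zero_to X Y (f : hom X Y) : is_zero Y -> f = 0.
Proof. by move=> Y0; rewrite -[f]comp1m Y0 comp0m. Qed.

Lemma is_iso_id X : is_iso (idm X).
Proof. by exists (idm X); rewrite comp1m. Qed.

Lemma is_iso_comp X Y Z (g : hom Y Z) (f : hom X Y) :
  is_iso g -> is_iso f -> is_iso (g ∘ f).
Proof.
case=> g' [g'g gg'] [f' [f'f ff']]; exists (f' ∘ g'); split.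
  by rewrite compmA -(compmA f') g'g compm1.
by rewrite compmA -(compmA g) ff' compm1.
Qed.

Lemma is_iso_zero X Y (f : hom X Y) : is_zero X -> is_zero Y -> is_iso f.
Proof. by move=> X0 Y0; exists 0; rewrite X0 Y0 comp0m compm0. Qed.

Lemma isomorphic_sym X Y : isomorphic X Y -> isomorphic Y X.
Proof. by case=> f [g [gf fg]]; exists g, f. Qed.

Lemma isomorphic_trans X Y Z :
  isomorphic X Y -> isomorphic Y Z -> isomorphic X Z.
Proof. by case=> f fi [g gi]; exists (g ∘ f); apply: is_iso_comp. Qed.

Lemma is_cokernel_epi X Y Z T (i : hom X Y) (p : hom Y Z) (f g : hom Z T) :
  is_cokernel i p -> f ∘ p = g ∘ p -> f = g.
Proof.
case=> p0 pU fg; have [|h [_ hU]] := pU T (f ∘ p).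
  by rewrite -compmA p0 compm0.
by rewrite -(hU f) // -(hU g).
Qed.

Lemma is_kernel_mono X Y Z T (i : hom X Y) (p : hom Y Z) (f g : hom T X) :
  is_kernel i p -> i ∘ f = i ∘ g -> f = g.
Proof.
case=> p0 pU fg; have [|h [_ hU]] := pU T (i ∘ f).
  by rewrite compmA p0 comp0m.
by rewrite -(hU f) // -(hU g).
Qed.

End ZeroObjects.

(** * Conflations with some outer terms replaced by zero *)

Section Cut.
Variable E : exact_category.
Implicit Types X Y Z : E.

Lemma confl_comp0 X Y Z (i : hom X Y) (p : hom Y Z) : confl i p -> p ∘ i = 0.
Proof. by case/confl_ker. Qed.

(** The axiom makes [idm Z] an inflation with some cokernel [W]; [W] must be zero, and [confl_iso]
    replaces it by the chosen zero object. *)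
Lemma confl_id0 Z : confl (idm Z) (0 : hom Z (zero_obj E)).
Proof.
have [W [p ip]] := adm_mono_id Z; have p0 : p = 0.
  by rewrite -[p]compm1 confl_comp0.
have W0 : is_zero W.
  by apply: (is_cokernel_epi (confl_coker ip)); rewrite p0 !compm0.
apply: (confl_iso (a := idm _) (b := idm _) (c := 0)) ip.
- exact: is_iso_id.
- exact: is_iso_id.
- exact: is_iso_zero W0 (zero_objP E).
- by [].
- by rewrite !comp0m.
Qed.

Lemma confl_0id Z : confl (0 : hom (zero_obj E) Z) (idm Z).
Proof.
have [W [i ip]] := adm_epi_id Z; have i0 : i = 0.
  by rewrite -[i]comp1m confl_comp0.
have W0 : is_zero W.
  by apply: (is_kernel_mono (confl_ker ip)); rewrite i0 !comp0m.
apply: (confl_iso (a := 0) (b := idm _) (c := idm _)) ip.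
- exact: is_iso_zero W0 (zero_objP E).
- exact: is_iso_id.
- exact: is_iso_id.
- by rewrite i0 !compm0.
- by [].
Qed.

Definition thin (b : bool) Z : E := if b then Z else zero_obj E.

(* The middle term of a conflation [thin b Z -> _ -> thin b' Z'], where
   [Z -> X -> Z'] is a given conflation. *)
Definition cut (b b' : bool) Z X Z' : E :=
  if b then if b' then X else Z else thin b' Z'.

Variables (Z X Z' : E) (i : hom Z X) (p : hom X Z').
Implicit Types b : bool.

Definition cut_in b b' : hom (thin b Z) (cut b b' Z X Z') :=
  match b, b' with
  | true, true => i | true, false => idm Z | false, _ => 0
  end.

Definition cut_out b b' : hom (cut b b' Z X Z') (thin b' Z') :=
  match b, b' with
  | true, true => p | false, true => idm Z' | _, false => 0
  end.

Lemma cut_confl b b' : confl i p -> confl (cut_in b b') (cut_out b b').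
Proof.
case: b b' => [] [] //= _; [exact: confl_id0 | exact: confl_0id |].
by have := confl_id0 (zero_obj E); rewrite zero_objP.
Qed.

(** [cut_sub] and [cut_quo] are the components of the chain maps [A -> X -> B]. In contrast,
    [cut_to] and [cut_from] below serve as the maps [k] and [s] of the splitting [id_X = s v + u k],
    which need not commute with differentials. *)
Definition cut_sub b b' : hom (cut b b' Z X Z') X :=
  match b, b' with true, true => idm X | true, false => i | false, _ => 0 end.

Definition cut_quo b b' : hom X (cut b b' Z X Z') :=
  match b, b' with true, true => idm X | false, true => p | _, false => 0 end.

Definition cut_to b b' : hom X (cut b b' Z X Z') :=
  match b, b' with true, true => idm X | _, _ => 0 end.

Definition cut_from b b' : hom (cut b b' Z X Z') X :=
  match b, b' with true, true => idm X | _, _ => 0 end.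

Variables (X' Z'' : E).

(* With [b, b'] the bits of a truncation [A] in degrees [n + 1] and [n + 2],
   these are maps between [B^n] and [A^(n+1)]; both terms are [Z'] when
   [b && ~~ b'], and the maps vanish otherwise. *)
Definition cut_link b b' :
    hom (cut (~~ b) (~~ b') Z X Z') (cut b b' Z' X' Z'') :=
  match b, b' with true, false => idm Z' | _, _ => 0 end.

Definition cut_knil b b' :
    hom (cut b b' Z' X' Z'') (cut (~~ b) (~~ b') Z X Z') :=
  match b, b' with true, false => idm Z' | _, _ => 0 end.

End Cut.
Arguments cut_in {E Z X} Z' i b b'.
Arguments cut_out {E} Z {X Z'} p b b'.
Arguments cut_sub {E Z X} Z' i b b'.
Arguments cut_quo {E} Z {X Z'} p b b'.
Arguments cut_to {E} Z X Z' b b'.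
Arguments cut_from {E} Z X Z' b b'.
Arguments cut_link {E} Z X Z' X' Z'' b b'.
Arguments cut_knil {E} Z X Z' X' Z'' b b'.

(** * Matrix calculus and a criterion for [B] to be a cone *)

Section Biproducts.
Variables (C : preadditive) (T U X Y : C) (B : biproduct X Y).

Lemma bprl_inlK (f : hom T X) : bprl B ∘ (binl B ∘ f) = f.
Proof. by rewrite compmA bprl_inl comp1m. Qed.

Lemma bprr_inrK (f : hom T Y) : bprr B ∘ (binr B ∘ f) = f.
Proof. by rewrite compmA bprr_inr comp1m. Qed.

Lemma bprl_inrK (f : hom T Y) : bprl B ∘ (binr B ∘ f) = 0.
Proof. by rewrite compmA bprl_inr comp0m. Qed.

Lemma bprr_inlK (f : hom T X) : bprr B ∘ (binl B ∘ f) = 0.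
Proof. by rewrite compmA bprr_inl comp0m. Qed.

Lemma biproduct_coext (f g : hom B U) :
  f ∘ binl B = g ∘ binl B -> f ∘ binr B = g ∘ binr B -> f = g.
Proof.
move=> fgl fgr; rewrite -[f]compm1 -[g]compm1 -(binpr B) !compmDr.
by rewrite !compmA fgl fgr.
Qed.

End Biproducts.

Definition biprE := (bprl_inl, bprr_inr, bprl_inr, bprr_inl,
  bprl_inlK, bprr_inrK, bprl_inrK, bprr_inlK).

Definition compE := (compmDl, compmDr, compNm, compmN, comp0m, compm0,
  comp1m, compm1, @oppr0, @opprK, @add0r, @addr0).

(* [id_X = s v + u k] with [v], [u] chain maps; the matrices [(w, s)^T] and
   [(w', v)] are then mutually inverse homotopy equivalences between [B] and
   the cone of [u], with homotopy [k]. *)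
Section ConeEquivalence.
Variables (C : additive) (A X B : complex C) (u : cmap A X) (v : cmap X B).
Variables (k : forall n, hom (X n) (A n)) (s : forall n, hom (B n) (X n)).
Variables (w : forall n, hom (B n) (A (n + 1)))
  (w' : forall n, hom (A (n + 1)) (B n)).
Hypotheses
  (wd : forall n, w (n + 1) ∘ diff B n = - (diff A (n + 1) ∘ w n))
  (sd : forall n, s (n + 1) ∘ diff B n = u (n + 1) ∘ w n + diff X n ∘ s n)
  (vu : forall n, v (n + 1) ∘ u (n + 1)
    = diff B n ∘ w' n + w' (n + 1) ∘ diff A (n + 1))
  (w'w_vs : forall n, w' n ∘ w n + v n ∘ s n = idm (B n))
  (ww'_ku : forall n, w n ∘ w' n + k (n + 1) ∘ u (n + 1) = idm (A (n + 1)))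
  (wv : forall n, w n ∘ v n = diff A n ∘ k n - k (n + 1) ∘ diff X n)
  (sw' : forall n, s n ∘ w' n = 0)
  (sv_uk : forall n, s n ∘ v n + u n ∘ k n = idm (X n)).

Let S n := dsum (A (n + 1)) (X n).

Fact to_coneP n :
  (binl (S (n + 1)) ∘ w (n + 1) + binr (S (n + 1)) ∘ s (n + 1)) ∘ diff B n
  = cone_diff u n ∘ (binl (S n) ∘ w n + binr (S n) ∘ s n).
Proof.
apply: biproduct_ext; rewrite /cone_diff !compE -!compmA !biprE !compE.
  exact: wd.
exact: sd.
Qed.

Definition to_cone : cmap B (cone u) := @CMap _ B (cone u) _ to_coneP.

Fact from_coneP n :
  (w' (n + 1) ∘ bprl (S (n + 1)) + v (n + 1) ∘ bprr (S (n + 1)))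
    ∘ cone_diff u n
  = diff B n ∘ (w' n ∘ bprl (S n) + v n ∘ bprr (S n)).
Proof.
apply: biproduct_coext; rewrite /cone_diff !compE -!compmA !biprE !compE.
  by rewrite vu addrCA addNr addr0.
exact: cmP.
Qed.

Definition from_cone : cmap (cone u) B := @CMap _ (cone u) B _ from_coneP.

Lemma from_to_cone : cmap_comp from_cone to_cone = cmap_id B.
Proof.
apply: cmap_eq => n; rewrite /= !compE -!compmA !biprE !compE.
exact: w'w_vs.
Qed.

Lemma to_from_cone :
  nullhomotopic (cmap_id (cone u) - cmap_comp to_cone from_cone).
Proof.
exists (fun n => binl (S n) ∘ k (n + 1) ∘ bprr (S (n + 1))) => n.
change (idm (S (n + 1)) -
  (binl (S (n + 1)) ∘ w (n + 1) + binr (S (n + 1)) ∘ s (n + 1)) ∘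
  (w' (n + 1) ∘ bprl (S (n + 1)) + v (n + 1) ∘ bprr (S (n + 1))) =
  binl (S (n + 1)) ∘ k (n + 1 + 1) ∘ bprr (S (n + 1 + 1)) ∘
    cone_diff u (n + 1) +
  cone_diff u n ∘ (binl (S n) ∘ k (n + 1) ∘ bprr (S (n + 1)))).
(* Comparing matrix entries leaves four goals, settled by [ww'_ku], [wv], [sw'] and [sv_uk] in
   turn. *)
apply: biproduct_ext; apply: biproduct_coext;
  rewrite /cone_diff ?compE -?compmA ?biprE ?compE.
- by rewrite [LHS]addrC; apply/esym/(canRL (addKr _))/ww'_ku.
- by rewrite wv opprB.
- by rewrite sw' oppr0.
- by rewrite [LHS]addrC; apply/esym/(canRL (addKr _))/sv_uk.
Qed.

Lemma from_cone_in : cmap_comp from_cone (cone_in u) = v.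
Proof.
apply: cmap_eq => n; rewrite /= -/(S n) compmDl -!compmA.
by rewrite bprl_inr bprr_inr compm0 add0r compm1.
Qed.

Lemma cone_triangle :
  exists w0 : hom (B : Kcat C) (shift A), K_distinguished (kpi u) (kpi v) w0.
Proof.
have ft : kcomp (kpi from_cone) (kpi to_cone) = kid B.
  by rewrite kcomp_pi from_to_cone.
have tf : kcomp (kpi to_cone) (kpi from_cone) = kid (cone u).
  by rewrite kcomp_pi; apply/esym/kpiP; apply: to_from_cone.
(* The connecting map is transported from the cone, so the last square commutes by construction. *)
exists (kcomp (kpi (cone_out u)) (kpi to_cone)).
exists A, X, u, (kid A), (kid X), (kpi to_cone); split; split.
- exact: (is_iso_id (A : Kcat C)).
- exact: (is_iso_id (X : Kcat C)).
- by exists (kpi from_cone).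
- by rewrite kcomp1m kcompm1.
- by rewrite -[in LHS]from_cone_in -kcomp_pi kcompA tf kcomp1m kcompm1.
- by rewrite kshift1 kcomp1m.
Qed.

End ConeEquivalence.

(** * Truncations of an acyclic complex and their triangle *)

Section CutComplex.
Variables (E : exact_category) (X : complex E) (Z : int -> E).
Variables (al : forall n, hom (Z n) (X n))
  (be : forall n, hom (X n) (Z (n + 1))).
Hypothesis conf : forall n, confl (al n) (be n).
Hypothesis dE : forall n, diff X n = al (n + 1) ∘ be n.
Implicit Types (a b : int -> bool).

Definition cut_ob b n := cut (b n) (b (n + 1)) (Z n) (X n) (Z (n + 1)).

Definition cut_diff b n : hom (cut_ob b n) (cut_ob b (n + 1)) :=
  cut_in _ (al (n + 1)) (b (n + 1)) (b (n + 1 + 1)) ∘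
  cut_out _ (be n) (b n) (b (n + 1)).

Fact cut_diff2 b n : cut_diff b (n + 1) ∘ cut_diff b n = 0.
Proof.
rewrite /cut_diff compmA -(compmA (cut_in _ _ _ _)).
by rewrite (confl_comp0 (cut_confl _ _ (conf _))) compm0 comp0m.
Qed.

Definition cut_complex b : complex E := Complex (cut_diff2 b).

Lemma cut_acyclic b : acyclic (cut_complex b).
Proof.
exists (fun n => thin (b n) (Z n)).
exists (fun n => cut_in _ (al n) (b n) (b (n + 1))).
exists (fun n => cut_out _ (be n) (b n) (b (n + 1))); split=> // n.
exact: cut_confl.
Qed.

Lemma cut_zero b n : ~~ b n -> ~~ b (n + 1) -> is_zero (cut_complex b n).
Proof.
by rewrite /= /cut_ob => /negbTE-> /negbTE->; apply: zero_objP.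
Qed.

(* [A] retains the [Z n] with [a n], and [B] those with [~~ a (n + 1)]: the last
   object retained by [A] is also the first one retained by [B]. *)
Variable a : int -> bool.
Hypothesis a_dec : forall n, a (n + 1) ==> a n.

Let b n := ~~ a (n + 1).
Let A := cut_complex a.
Let B := cut_complex b.

Let u n : hom (A n) (X n) := cut_sub _ (al n) (a n) (a (n + 1)).
Let v n : hom (X n) (B n) := cut_quo _ (be n) (b n) (b (n + 1)).
Let k n : hom (X n) (A n) := cut_to _ _ _ (a n) (a (n + 1)).
Let s n : hom (B n) (X n) := cut_from _ _ _ (b n) (b (n + 1)).
Let w n : hom (B n) (A (n + 1)) :=
  cut_link _ _ _ _ _ (a (n + 1)) (a (n + 1 + 1)).
Let w' n : hom (A (n + 1)) (B n) :=
  cut_knil _ _ _ _ _ (a (n + 1)) (a (n + 1 + 1)).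

Let be_al n : be n ∘ al n = 0. Proof. exact: confl_comp0. Qed.

Let zid : idm (zero_obj E) = 0. Proof. exact: zero_objP. Qed.

(** The identities below involve at most the bits of [a] at [n], ..., [n + 3]. Monotonicity leaves
    five patterns, and in each one the cut objects and maps compute. *)
Ltac case_cut n :=
  rewrite /= /cut_diff ?dE /=;
  move: (a_dec n) (a_dec (n + 1)) (a_dec (n + 1 + 1));
  rewrite /A /B /u /v /k /s /w /w' /b /cut_ob /=;
  case: (a n); case: (a (n + 1)); case: (a (n + 1 + 1));
  case: (a (n + 1 + 1 + 1)) => //= _ _ _;
  rewrite ?compE ?subrr ?zid //.

Fact cut_subP n : u (n + 1) ∘ diff A n = diff X n ∘ u n.
Proof. by case_cut n; rewrite -compmA be_al compm0. Qed.

Fact cut_quoP n : v (n + 1) ∘ diff X n = diff B n ∘ v n.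
Proof. by case_cut n; rewrite compmA be_al comp0m. Qed.

Definition cut_sub_map : cmap A X := CMap cut_subP.
Definition cut_quo_map : cmap X B := CMap cut_quoP.

Lemma cut_triangle :
  exists w0 : hom (B : Kcat E) (shift A),
    K_distinguished (kpi cut_sub_map) (kpi cut_quo_map) w0.
Proof.
by apply: (cone_triangle (k := k) (s := s) (w := w) (w' := w')) => n;
  case_cut n.
Qed.

End CutComplex.

(** * Vanishing of morphisms *)

Section HomVanishing.
Variables (E : exact_category) (X Y : complex E).

Lemma acyclic_nullhomotopic (f : cmap X Y) : acyclic X ->
  (forall n : int, 0 < n -> is_zero (X n)) ->
  (forall n : int, n < - 1 -> is_zero (Y n)) -> nullhomotopic f.
Proof.
case=> Z [al [be [conf dE]]] X0 Y0.
have be_epi n T (p q : hom (Z (n + 1)) T) : p ∘ be n = q ∘ be n -> p = q.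
  exact: is_cokernel_epi (confl_coker (conf n)).
have al_mono n T (p q : hom T (Z n)) : al n ∘ p = al n ∘ q -> p = q.
  exact: is_kernel_mono (confl_ker (conf n)).
(* Only the component [X^0 -> Y^-1] of the homotopy may be nonzero, so in each degree at most one of
   the two homotopy terms survives. *)
pose P n (h : hom (X (n + 1)) (Y n)) := [/\ n != -1 -> h = 0,
  n <= -1 -> f n = h ∘ diff X n & -1 <= n -> f (n + 1) = diff Y n ∘ h].
have exP n : exists h, P n h.
  rewrite /P.
  have [n1|n1|n1] := ltgtP n (-1).
  - exists 0; split=> // _.
    by rewrite comp0m; apply/is_zero_to/Y0.
  - exists 0; split=> // _.
    by rewrite compm0; apply/is_zero_from/X0; lia.
  (* Here [n = -1]: [Z^1] embeds in [X^1 = 0], so [al^0] is invertible, with inverse [r]. *)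
  have Z0 : is_zero (Z (n + 1 + 1)).
    by apply: al_mono; rewrite compm0 compm1; apply/is_zero_to/X0; lia.
  have [r [alr _]] := (confl_ker (conf (n + 1))).2 _ (idm (X (n + 1)))
    (is_zero_to _ Z0).
  (* It suffices to precompose with the epimorphism [X^-2 -> Z^-1]; the result [f^-1 d = d f^-2]
     vanishes because [Y^-2 = 0]. *)
  have fal : f n ∘ al n = 0.
    rewrite -[n](subrK 1); apply: be_epi; rewrite -compmA -dE cmP comp0m.
    by rewrite (is_zero_to (f (n - 1))) ?compm0 //; apply: Y0; lia.
  have [h [hbe _]] := (confl_coker (conf n)).2 _ _ fal.
  have hrd : h ∘ r ∘ diff X n = f n.
    rewrite dE compmA -(compmA h) -hbe; congr (_ ∘ _).
    rewrite -[RHS]compm1; congr (_ ∘ _).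
    by apply: al_mono; rewrite compmA alr comp1m compm1.
  exists (h ∘ r); split=> // _.
  (* Since [al^0] is invertible and [be^-1] is epi, it is enough to compare after
     [d : X^-1 -> X^0]. *)
  rewrite -[LHS]compm1 -[RHS]compm1 -alr !compmA; congr (_ ∘ r).
  apply: be_epi; rewrite -[LHS]compmA -[RHS]compmA -dE cmP.
  by rewrite -!compmA; congr (_ ∘ _); rewrite compmA hrd.
have [h hP] : exists h, forall n, P n (h n).
  by exists (fun n => sval (cid (exP n))) => n; apply: svalP.
exists h => n; have [h0 _ hd] := hP n; have [h'0 h'd _] := hP (n + 1).
have [n1|n1] := leP (n + 1) (-1).
  by rewrite h0 ?compm0 ?addr0 -?h'd //; lia.
by rewrite h'0 ?comp0m ?add0r ?hd //; lia.
Qed.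

End HomVanishing.

(** * Inverse translation of complexes *)

Section Unshift.
Variable C : preadditive.

(** [F (n + 1 - 1)] and [F n] are not convertible; casting by a morphism lets the cast compose with
    differentials. *)
Definition transp (F : int -> C) m n (e : m = n) : hom (F m) (F n) :=
  eq_rect m (fun j => hom (F m) (F j)) (idm (F m)) n e.

Lemma transp_iso (F : int -> C) m n (e : m = n) : is_iso (transp F e).
Proof. by case: n / e; apply: is_iso_id. Qed.

Lemma transp_nat (F G : int -> C) (f : forall n, hom (F n) (G n)) m n
    (e : m = n) : f n ∘ transp F e = transp G e ∘ f m.
Proof. by case: n / e; rewrite /= comp1m compm1. Qed.

Lemma transp_comp (F : int -> C) l m n (e : m = n) (e' : l = m) :
  transp F e ∘ transp F e' = transp F (etrans e' e).
Proof. by case: n / e; rewrite /= comp1m. Qed.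

Lemma transp_shift (F : int -> C) m n (e : m = n) (e' : m + 1 = n + 1) :
  transp F e' = transp (fun j => F (j + 1)) e.
Proof. by case: n / e e' => e'; rewrite (eq_irrelevance e' erefl). Qed.

Lemma subrK_addrK (n : int) : n - 1 + 1 = n + 1 - 1.
Proof. by rewrite subrK addrK. Qed.

Variable Y : complex C.

(* The sign cancels the one of [shift]. *)
Definition unshift_diff (n : int) : hom (Y (n - 1)) (Y (n + 1 - 1)) :=
  - (transp Y (subrK_addrK n) ∘ diff Y (n - 1)).

Fact unshift_diff2 n : unshift_diff (n + 1) ∘ unshift_diff n = 0.
Proof.
rewrite /unshift_diff compNm compmN opprK -compmA (compmA (diff Y _)).
rewrite (transp_nat (F := Y) (G := fun j => Y (j + 1)) (diff Y)).
by rewrite -!compmA diff2 !compm0.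
Qed.

Definition unshift : complex C := Complex unshift_diff2.

Fact shift_unshiftP n : transp Y (addrK 1 (n + 1)) ∘ diff (shift unshift) n
  = diff Y n ∘ transp Y (addrK 1 n).
Proof.
rewrite (transp_nat (F := Y) (G := fun j => Y (j + 1)) (diff Y)).
rewrite /= /unshift_diff opprK compmA transp_comp.
by congr (_ ∘ _); apply: transp_shift.
Qed.

Lemma shift_unshift : isomorphic (shift unshift : Kcat C) Y.
Proof.
pose f : cmap (shift unshift) Y := CMap shift_unshiftP.
pose ti n : hom (Y n) (Y (n + 1 - 1)) := transp Y (esym (addrK 1 n)).
have tK n : transp Y (addrK 1 n) ∘ ti n = idm (Y n).
  (* Proofs of an equality of integers are unique, so a cast around a loop is the identity. *)
  by rewrite transp_comp (eq_irrelevance (etrans _ _) erefl).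
have Kt n : ti n ∘ transp Y (addrK 1 n) = idm (Y (n + 1 - 1)).
  by rewrite transp_comp (eq_irrelevance (etrans _ _) erefl).
have giP n : ti (n + 1) ∘ diff Y n = diff (shift unshift) n ∘ ti n.
  rewrite -[LHS]compm1 -(tK n) -compmA (compmA (diff Y n)) -shift_unshiftP.
  by rewrite !compmA Kt comp1m.
exists (kpi f), (kpi (@CMap _ Y (shift unshift) _ giP)).
by split; rewrite /= kcomp_pi; congr kpi; apply: cmap_eq => n /=.
Qed.

End Unshift.

Lemma unshift_acyclic (E : exact_category) (Y : complex E) :
  acyclic Y -> acyclic (unshift Y).
Proof.
case=> Z [al [be [conf dE]]].
exists (fun n => Z (n - 1)), (fun n => al (n - 1)).
exists (fun n => - (transp Z (subrK_addrK n) ∘ be (n - 1))); split=> n.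
  apply: (confl_iso (a := idm _) (b := idm _)
    (c := - transp Z (subrK_addrK n))) (conf (n - 1)).
  - exact: is_iso_id.
  - exact: is_iso_id.
  - have [g [gt tg]] := transp_iso Z (subrK_addrK n).
    by exists (- g); rewrite !compNm !compmN !opprK.
  - by rewrite comp1m compm1.
  - by rewrite compm1 compNm.
rewrite /= /unshift_diff dE compmN !compmA.
by rewrite (transp_nat (F := Z) (G := Y) al).
Qed.

(** * Translation is fully faithful *)

Lemma int_succ_ind (P : int -> Prop) :
  (forall n, P (n + 1)) -> forall n, P n.
Proof. by move=> PS n; rewrite -[n](subrK 1). Qed.

(** Every integer is a successor; this undoes the reindexing made by [shift]. *)
Lemma int_succ_rect (F : int -> Type) (s : forall n, F (n + 1)) :
  exists t : forall n, F n, forall n, t (n + 1) = s n.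
Proof.
exists (fun n => eq_rect _ F (s (n - 1)) n (subrK 1 n)) => n.
move: (n + 1 - 1) (addrK 1 n) (subrK 1 (n + 1)) => m -> e.
by rewrite (eq_irrelevance e erefl).
Qed.

Section FullyFaithful.
Variable C : preadditive.
Implicit Types X Y : complex C.

Lemma kshift_full X Y (f : khom (shift X) (shift Y)) :
  exists g : khom X Y, kshift g = f.
Proof.
rewrite -[f]kpi_repr; set f' := repr f.
have [g gE] := int_succ_rect (F := fun n => hom (X n) (Y n)) f'.
have gP n : g (n + 1) ∘ diff X n = diff Y n ∘ g n.
  elim/int_succ_ind: n => n; rewrite !gE; have := cmP f' n.
  by rewrite /= compmN compNm => /oppr_inj.
exists (kpi (CMap gP)); rewrite kshift_pi; congr kpi.
exact: cmap_eq.
Qed.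

Lemma kshift_inj X Y : injective (@kshift C X Y).
Proof.
move=> f g; rewrite -[f]kpi_repr -[g]kpi_repr !kshift_pi => /kpiP[h hP].
apply/kpiP.
have [h' h'E] := int_succ_rect (F := fun n => hom (X (n + 1)) (Y n)) h.
(* The sign offsets that of the differentials of [shift]. *)
exists (fun n => - h' n); elim/int_succ_ind => n; rewrite !h'E.
by have := hP n; rewrite /= !compmN !compNm.
Qed.

Lemma shift_isomorphic X Y :
  isomorphic (shift X : Kcat C) (shift Y) -> isomorphic (X : Kcat C) Y.
Proof.
case=> f [g]; have [f' <-] := kshift_full f; have [g' <-] := kshift_full g.
rewrite /= -!kshiftM -!kshift1 => -[/kshift_inj gf /kshift_inj fg].
by exists f', g'.
Qed.

End FullyFaithful.

(** Translating a representative of [X[1]] back by one degree moves the bound from [-2] to [-1];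
    full faithfulness carries the isomorphism back. *)
Lemma tge1_Ac_ge0P (E : exact_category) (X : Ac E) : tge1 (@Ac_ge0 E) X ->
  exists Y : Ac E, isomorphic X Y /\
    forall i : int, i < - 1 -> is_zero (Ac_complex Y i).
Proof.
case=> Y [XY Y0].
exists (exist _ (unshift (sval Y)) (unshift_acyclic (svalP Y))); split.
  apply: (shift_isomorphic (X := sval X)).
  apply: isomorphic_trans (isomorphic_sym (shift_unshift _)).
  exact: XY.
by move=> i i1; apply: Y0; lia.
Qed.

(** * Verification of the axioms of a t-structure *)

Theorem lemma1p2 (E : exact_category) (hE : idempotent_complete E) :
  t_structure (@Ac_le0 E) (@Ac_ge0 E).
Proof.
split.
- move=> X Y XY [W [XW W0]]; exists W; split=> //.
  exact: isomorphic_trans (isomorphic_sym XY) XW.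
- move=> X Y XY [W [XW W0]]; exists W; split=> //.
  exact: isomorphic_trans (isomorphic_sym XY) XW.
- move=> X [W [[f [g [gf fg]]] W0]]; exists (tr W); split.
    exists (trm f), (trm g); split; first by rewrite -trmM gf trm1.
    by rewrite -trmM fg trm1.
  by move=> i i0; apply: W0; lia.
- move=> X /tge1_Ac_ge0P[Y [XY Y0]]; exists Y; split=> // i i2.
  by apply: Y0; lia.
- move=> X Y f [X' [[p [q [qp _]]] X'0]].
  case/tge1_Ac_ge0P=> Y' [[r [t [tr _]]] Y'0].
  (* Conjugating [f] by the isomorphisms reduces to representatives that satisfy the vanishing
     conditions strictly. *)
  have z : r ∘ f ∘ q = 0.
    rewrite -[LHS]kpi_repr; apply/kpi_eq0.
    by apply: acyclic_nullhomotopic; first exact: (svalP X').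
  rewrite -[f]comp1m -tr -[f]compm1 -qp.
  by rewrite -compmA (compmA r) (compmA (r ∘ f)) z comp0m compm0.
- move=> [X [Z [al [be [conf dE]]]]].
  pose a (n : int) := n <= 0.
  have a_dec n : a (n + 1) ==> a n by rewrite /a; lia.
  have [w uvw] := cut_triangle conf dE a_dec.
  pose b n := ~~ a (n + 1).
  pose A : Ac E := exist _ _ (cut_acyclic conf a).
  pose B : Ac E := exist _ _ (cut_acyclic conf b).
  exists A, B, (kpi (cut_sub_map conf dE a_dec)).
  exists (kpi (cut_quo_map conf dE a_dec)), w; split=> //.
  + exists A; split; first by exists (idm A); exact: is_iso_id.
    by move=> i i0; apply: cut_zero; rewrite /a; lia.
  (* [B] starts in degree [-1], hence [B[1]] in degree [-2]. *)
  + exists (tr B); split; first by exists (idm (tr B)); exact: is_iso_id.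
    by move=> i i0; apply: cut_zero; rewrite /b /a; lia.
Qed.
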